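(* Let $G$ be an integral hyperelliptic graph of genus $\ge2$. Then there is a canonical isomorphism $$\mathrm{Jac}(G_{\mathbb{Z}})\cong\Phi(G),$$ equivariant for the action of $\mathrm{Aut}\,G_{\mathbb{Z}}=\mathrm{Aut}\,G$.
   Context: Graphs are finite topological graphs with a chosen vertex set; loops and multiple edges are allowed, a loop counts twice in the degree. Isomorphisms of graphs are homotopy classes of homeomorphisms preserving vertices and edges (equivalently, incidence-preserving bijections of vertices and half-edges; loops may be reversed). A (closed) hyperelliptic graph is a connected graph $G$ with a genus function $g:V(G)\to\mathbb{Z}_{\ge0}$ and a graph isomorphism $\iota:G\to G$ with $\iota^2=1$ such that (1) vertices of non-zero genus are $\iota$-invariant; (2) genus $0$ vertices have degree $\ge3$; (3) $2g(v)+2\ge\#\{\iota\text{-invariant edges at }v\}$ for every vertex $v$ ($\iota$-invariant means fixed pointwise); (4) the topological quotient $G/\langle\iota\rangle$ is a tree. (Exceptional graphs of genus $0$ and $1$ are irrelevant here.) Its genus is $\mathrm{rk}\,H_1(G,\mathbb{Z})+\sum_vg(v)$. A metric hyperelliptic graph carries an $\iota$-invariant length function $E(G)\to\mathbb{R}_{>0}$; in genus $\ge2$ it is integral if all lengths are integers. $\mathrm{Aut}\,G$ is the group of automorphisms preserving vertices, edges, genera, lengths, and commuting with $\iota$. $\Lambda=H_1(G,\mathbb{Z})$ carries the pairing induced from $1$-chains by $\langle e,e'\rangle=\mathrm{length}(e)$ if $e=e'$ and $0$ otherwise. For $G$ integral the Tamagawa group is $\Phi(G)=\Lambda^\vee/\Lambda$,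 where $\Lambda^\vee=\mathrm{Hom}(\Lambda,\mathbb{Z})$ and $\Lambda\hookrightarrow\Lambda^\vee$ by $x\mapsto\langle x,-\rangle$, with the induced action of $\mathrm{Aut}\,G$. For integral $G$, $G_{\mathbb{Z}}$ is the graph with the same underlying space whose vertices are the points at integer distance from the vertices of $G$: each edge of length $l$ is subdivided into $l$ edges of length $1$. It is regarded as a finite combinatorial graph with unweighted edges (loops and multiple edges allowed), disregarding genera; $\mathrm{Aut}\,G_{\mathbb{Z}}=\mathrm{Aut}\,G$ acts on it. For a finite combinatorial graph $\mathcal{G}$ (loops and multiple edges allowed), $\mathrm{Div}(\mathcal{G})$ is the free $\mathbb{Z}$-module on $V(\mathcal{G})$ and $\mathrm{Div}^0(\mathcal{G})$ the subgroup of elements with coefficient sum $0$. For vertices $v,v'$ put $v\cdot v'=\deg(v)-2\#\{\text{loops at }v\}$ if $v=v'$ and $v\cdot v'=-\#\{\text{edges between }v\text{ and }v'\}$ if $v\ne v'$; let $\alpha:\mathrm{Div}(\mathcal{G})\to\mathrm{Div}(\mathcal{G})$ be the linear map $\alpha(v)=\sum_{v'}(v\cdot v')v'$ and $\mathrm{Prin}(\mathcal{G})=\mathrm{im}(\alpha)$. Then $\mathrm{Jac}(\mathcal{G})=\mathrm{Div}^0(\mathcal{G})/\mathrm{Prin}(\mathcal{G})$, with the action induced by that of automorphisms on vertices. *)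

(* Defs.v *)
From HB Require Import structures.
From mathcomp Require Import all_fingroup all_boot all_order all_algebra.
From mathcomp Require Import boolp functions.

Set Implicit Arguments.
Unset Strict Implicit.
Unset Printing Implicit Defensive.

Import GRing.Theory Quotient.
Local Open Scope ring_scope.
Local Open Scope quotient_scope.

Section Kernel.
Variables (M N : zmodType) (f : {additive M -> N}).

Definition kerp : M -> bool := fun x => f x == 0.

Lemma kerp_zmod_closed : zmod_closed kerp.
Proof.
split=> [|x y]; rewrite /in_mem /= /kerp ?raddf0 // => /eqP fx /eqP fy.
by rewrite raddfB fx fy subrr.
Qed.

HB.instance Definition _ := GRing.isZmodClosed.Build M kerp kerp_zmod_closed.

Definition Ker := {x : M | kerp x}.

Definition inKer (x : M) (fx : f x = 0) : Ker :=
  exist (fun x => kerp x) x (introT eqP fx).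

HB.instance Definition _ := SubChoice.on Ker.
HB.instance Definition _ := [SubChoice_isSubZmodule of Ker by <:].

End Kernel.

Section Image.
Variables (M N : zmodType) (f : {additive M -> N}).

Definition imp : N -> bool := fun y => `[< exists x, y = f x >].

Lemma imp_zmod_closed : zmod_closed imp.
Proof.
split; first by apply/asboolP; exists 0; rewrite raddf0.
by move=> _ _ /asboolP[x ->] /asboolP[y ->]; apply/asboolP; exists (x - y);
  rewrite raddfB.
Qed.

HB.instance Definition _ := GRing.isZmodClosed.Build N imp imp_zmod_closed.

Definition Im : zmodClosed N := GRing.ZmodClosed.clone N imp _.

End Image.

Section Preimage.
Variables (M N : zmodType) (f : {additive M -> N}) (S : zmodClosed N).

Definition preimp : M -> bool := fun x => f x \in S.

Lemma preimp_zmod_closed : zmod_closed preimp.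
Proof.
split=> [|x y]; rewrite /in_mem /= /preimp ?raddf0 ?rpred0 //.
by move=> fx fy; rewrite raddfB rpredB.
Qed.

HB.instance Definition _ :=
  GRing.isZmodClosed.Build M preimp preimp_zmod_closed.

Definition Preim : zmodClosed M := GRing.ZmodClosed.clone M preimp _.

End Preimage.

Section Dual.
Variable M : zmodType.

Definition addp : (M -> int) -> bool :=
  fun f => `[< {morph f : x y / x + y} >].

Lemma addp_zmod_closed : zmod_closed addp.
Proof.
split; first by apply/asboolP => x y; rewrite [RHS]addr0.
move=> f g /asboolP fD /asboolP gD; apply/asboolP => x y.
by rewrite !fctE fD gD opprD addrACA.
Qed.

HB.instance Definition _ :=
  GRing.isZmodClosed.Build (M -> int) addp addp_zmod_closed.

Definition dual := {f : M -> int | addp f}.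

HB.instance Definition _ := SubChoice.on dual.
HB.instance Definition _ := [SubChoice_isSubZmodule of dual by <:].

Definition Dual (f : M -> int) (fD : {morph f : x y / x + y}) : dual :=
  exist (fun f => addp f) f (asboolT fD).

End Dual.

(* M is free with a Z-basis of r elements. *)
Definition has_rank (M : zmodType) (r : nat) : Prop :=
  exists b : 'I_r -> M,
    bijective (fun c : {ffun 'I_r -> int} => \sum_i b i *~ c i).

(* The orbits of f, when f is an involution. *)
Definition orbits (T : finType) (f : T -> T) : {set {set T}} :=
  [set [set x; f x] | x : T].

Definition orb (T : finType) (f : T -> T) := {A : {set T} | A \in orbits f}.

HB.instance Definition _ (T : finType) (f : T -> T) := SubFinite.on (orb f).

Section Orbits.
Variables (T : finType) (f : T -> T).

Lemma orb_of_subproof (x : T) : [set x; f x] \in orbits f.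
Proof. exact: imset_f. Qed.

Definition orb_of (x : T) : orb f :=
  exist (fun A => A \in orbits f) [set x; f x] (orb_of_subproof x).

Lemma orb_ex (A : orb f) : exists x, x \in val A.
Proof. by case: A => A /= /imsetP[x _ ->]; exists x; rewrite set21. Qed.

Definition orb_repr (A : orb f) : T := xchoose (orb_ex A).

Lemma orb_reprP (A : orb f) : orb_repr A \in val A.
Proof. exact: xchooseP. Qed.

Hypothesis fK : involutive f.

Lemma orb_reprE (x : T) : orb_repr (orb_of x) = x \/ orb_repr (orb_of x) = f x.
Proof. by have := orb_reprP (orb_of x); rewrite !inE => /orP[]/eqP; auto. Qed.

Lemma orb_ofE (x y : T) : orb_of x = orb_of y <-> (x = y \/ x = f y).
Proof.
split=> [[] E|].
  have: x \in [set y; f y] by rewrite -E set21.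
  by rewrite !inE => /orP[]/eqP; auto.
by case=> -> //; apply: val_inj; rewrite /= fK setUC.
Qed.

Lemma orb_ofK (A : orb f) : orb_of (orb_repr A) = A.
Proof.
apply: val_inj => /=; have := orb_reprP A.
case: A => A iA /=; move: (orb_repr _) => y.
case/imsetP: iA => x _ ->; rewrite !inE => /orP[]/eqP -> //.
by rewrite fK setUC.
Qed.

End Orbits.

(* A dart is a half-edge, i.e. an edge with an orientation: d goes from src d
   to src (drev d). *)
Record graph := Graph {
  vert : finType;
  dart : finType;
  src : dart -> vert;
  drev : dart -> dart;
  drevK : involutive drev;
  drev_neq : forall d, drev d != d }.

Definition tgt (G : graph) (d : dart G) : vert G := src (drev d).

Notation edge G := (orb (@drev G)).

Definition edge_of (G : graph) (d : dart G) : edge G := orb_of (@drev G) d.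

Lemma edge_of_drev (G : graph) (d : dart G) : edge_of (drev d) = edge_of d.
Proof. by apply/(orb_ofE (@drevK G)); right. Qed.

Section Graph.
Variable G : graph.

Definition ends (e : edge G) : {set vert G} := [set src d | d in val e].

Definition valency (v : vert G) : nat := #|[set d | src d == v]|.

(* For v = v' these are the loops at v. *)
Definition edges_between (v v' : vert G) : nat :=
  #|[set e | ends e == [set v; v']]|.

Definition adj : rel (vert G) :=
  fun v v' => [exists d : dart G, (src d == v) && (tgt d == v')].

Definition graph_connected : Prop :=
  (0 < #|vert G|)%N /\ forall v v' : vert G, connect adj v v'.

Definition consecutive : rel (dart G) :=
  fun d d' => (tgt d == src d') && (d' != drev d).

(* No simple closed walk, given by its cyclic list of darts; loops and pairs
   of parallel edges count as such, an edge followed back and forth does not. *)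
Definition acyclic : Prop :=
  forall c : seq (dart G),
    cycle consecutive c -> uniq [seq src d | d <- c] -> c = [::].

Definition is_tree : Prop := graph_connected /\ acyclic.

(* 1-chains as antisymmetric functions on darts: the oriented edge d is the
   function with value 1 at d, -1 at drev d and 0 elsewhere. *)
Definition symm (c : {ffun dart G -> int}) : {ffun dart G -> int} :=
  [ffun d => c d + c (drev d)].

Fact symm_additive : zmod_morphism symm.
Proof. by move=> c c'; apply/ffunP => d; rewrite !ffunE opprD addrACA. Qed.

HB.instance Definition _ := GRing.isZmodMorphism.Build _ _ symm symm_additive.

Definition C1 : zmodType := Ker symm.

Definition Div : zmodType := {ffun vert G -> int}.

Definition bdry (c : C1) : Div :=
  [ffun v => \sum_(d : dart G | tgt d == v) val c d].

Fact bdry_additive : zmod_morphism bdry.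
Proof.
move=> c c'; apply/ffunP => v; rewrite !ffunE -sumrB.
by apply: eq_bigr => d _; rewrite !ffunE.
Qed.

HB.instance Definition _ := GRing.isZmodMorphism.Build _ _ bdry bdry_additive.

Definition H1 : zmodType := Ker bdry.

Lemma chain_drev (c : C1) (d : dart G) : val c (drev d) = - val c d.
Proof.
case: c => c /= /eqP/ffunP/(_ d); rewrite !ffunE => /eqP.
by rewrite addrC addr_eq0 => /eqP.
Qed.

(* The terms do not depend on the orientation of e given by orb_repr. *)
Definition pairing (w : edge G -> nat) (c c' : C1) : int :=
  \sum_(e : edge G) (w e)%:Z * (val c (orb_repr e) * val c' (orb_repr e)).

Lemma pairingDr w (c : C1) : {morph pairing w c : x y / x + y}.
Proof.
move=> x y; rewrite /pairing -big_split /=; apply: eq_bigr => e _.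
by rewrite ffunE !mulrDr.
Qed.

Lemma pairingBl w (x y c : C1) :
  pairing w (x - y) c = pairing w x c - pairing w y c.
Proof.
rewrite /pairing -sumrB; apply: eq_bigr => e _.
by rewrite !ffunE mulrBl mulrBr.
Qed.

Definition to_dual (w : edge G -> nat) (x : H1) : dual H1 :=
  @Dual H1 (fun y => pairing w (val x) (val y))
    (fun y z => pairingDr w (val x) (val y) (val z)).

Fact to_dual_additive w : zmod_morphism (to_dual w).
Proof. by move=> x y; apply: val_inj; apply: funext => z; apply: pairingBl. Qed.

HB.instance Definition _ w :=
  GRing.isZmodMorphism.Build _ _ (to_dual w) (to_dual_additive w).

Definition degree (D : Div) : int := \sum_v D v.

Fact degree_additive : zmod_morphism degree.
Proof.
by move=> D D'; rewrite /degree -sumrB; apply: eq_bigr => v _; rewrite !ffunE.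
Qed.

HB.instance Definition _ :=
  GRing.isZmodMorphism.Build _ _ degree degree_additive.

Definition Div0 : zmodType := Ker degree.

Definition intersection (v v' : vert G) : int :=
  if v == v' then (valency v)%:Z - (2 * edges_between v v)%N%:Z
  else - (edges_between v v')%:Z.

Definition alpha (D : Div) : Div :=
  [ffun v' => \sum_v D v * intersection v v'].

Fact alpha_additive : zmod_morphism alpha.
Proof.
move=> D D'; apply/ffunP => v; rewrite !ffunE -sumrB.
by apply: eq_bigr => v' _; rewrite !ffunE mulrBl.
Qed.

HB.instance Definition _ := GRing.isZmodMorphism.Build _ _ alpha alpha_additive.

Definition Prin : zmodClosed Div := Im alpha.

Definition Jac : zmodType := {quot (Preim (val : Div0 -> Div) Prin)}.

End Graph.

Record aut (G : graph) := Aut {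
  av : {perm vert G};
  ad : {perm dart G};
  ad_src : forall d, src (ad d) = av (src d);
  ad_drev : forall d, ad (drev d) = drev (ad d) }.

Section Aut.
Variable G : graph.

Lemma aut_inv_src (s : aut G) (d : dart G) :
  src ((ad s)^-1%g d) = (av s)^-1%g (src d).
Proof. by apply: (@perm_inj _ (av s)); rewrite -ad_src !permKV. Qed.

Lemma aut_inv_drev (s : aut G) (d : dart G) :
  (ad s)^-1%g (drev d) = drev ((ad s)^-1%g d).
Proof. by apply: (@perm_inj _ (ad s)); rewrite ad_drev !permKV. Qed.

Definition aut_inv (s : aut G) : aut G :=
  Aut (aut_inv_src s) (aut_inv_drev s).

Definition edge_act (s : aut G) (e : edge G) : edge G :=
  edge_of (ad s (orb_repr e)).

Lemma edge_act_of (s : aut G) (d : dart G) :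
  edge_act s (edge_of d) = edge_of (ad s d).
Proof.
have := orb_reprE (@drev G) d; rewrite /edge_act -/(edge_of d).
by case=> ->; rewrite ?ad_drev ?edge_of_drev.
Qed.

(* The quotient of G by an involution s, computed on the barycentric
   subdivision of G: the vertices of the latter are the vertices and the
   midpoints of the edges of G and its edges are the half-edges of G, so that s
   fixes pointwise every edge that it maps to itself.  A dart (A, true) of the
   quotient leads from the vertex of a half-edge in A to a midpoint. *)
Section Quotient.
Variable s : aut G.

Definition quo_vert : finType := (orb (av s) + orb (edge_act s))%type.
Definition quo_dart : finType := (orb (ad s) * bool)%type.

Definition quo_src (a : quo_dart) : quo_vert :=
  let d := orb_repr a.1 in
  if a.2 then inl (orb_of (av s) (src d))
  else inr (orb_of (edge_act s) (edge_of d)).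

Definition quo_drev (a : quo_dart) : quo_dart := (a.1, ~~ a.2).

Lemma quo_drevK : involutive quo_drev.
Proof. by case=> A b; rewrite /quo_drev /= negbK. Qed.

Lemma quo_drev_neq a : quo_drev a != a.
Proof. by case: a => A b; rewrite /quo_drev xpair_eqE eqxx /=; case: b. Qed.

Definition quotient_graph : graph := Graph quo_src quo_drevK quo_drev_neq.

End Quotient.

Lemma C1_act_subproof (s : aut G) (c : C1 G) :
  symm [ffun d => val c ((ad s)^-1%g d)] = 0.
Proof.
apply/ffunP => d; rewrite !ffunE aut_inv_drev chain_drev.
exact: subrr.
Qed.

Definition C1_act (s : aut G) (c : C1 G) : C1 G :=
  inKer (C1_act_subproof s c).

Definition Div_act (s : aut G) (D : Div G) : Div G :=
  [ffun v => D ((av s)^-1%g v)].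

Lemma bdry_act (s : aut G) (c : C1 G) :
  bdry (C1_act s c) = Div_act s (bdry c).
Proof.
apply/ffunP => v; rewrite !ffunE (reindex_perm (ad s)) /=.
apply: eq_big => [d|d _]; last by rewrite ffunE permK.
by rewrite /tgt -ad_drev ad_src (canF_eq (permK _)).
Qed.

Lemma H1_act_subproof (s : aut G) (x : H1 G) :
  bdry (C1_act s (val x)) = 0.
Proof.
rewrite bdry_act; case: x => c /= /eqP ->.
by apply/ffunP => v; rewrite !ffunE.
Qed.

Definition H1_act (s : aut G) (x : H1 G) : H1 G :=
  inKer (H1_act_subproof s x).

Lemma Div0_act_subproof (s : aut G) (D : Div0 G) :
  degree (Div_act s (val D)) = 0.
Proof.
case: D => D /= /eqP D0; rewrite -[RHS]D0 /degree (reindex_perm (av s)) /=.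
by apply: eq_bigr => v _; rewrite ffunE permK.
Qed.

Definition Div0_act (s : aut G) (D : Div0 G) : Div0 G :=
  inKer (Div0_act_subproof s D).

Lemma edge_act_inj (s : aut G) : injective (edge_act s).
Proof.
apply: (can_inj (g := edge_act (aut_inv s))) => e.
by rewrite -[e](orb_ofK (@drevK G)) -/(edge_of _) !edge_act_of /= permK.
Qed.

Lemma ends_act (s : aut G) (e : edge G) :
  ends (edge_act s e) = av s @: ends e.
Proof.
rewrite -[e](orb_ofK (@drevK G)) -/(edge_of _) edge_act_of /ends /=.
by rewrite !imsetU !imset_set1 -ad_drev !ad_src.
Qed.

Lemma edges_between_act (s : aut G) (v v' : vert G) :
  edges_between (av s v) (av s v') = edges_between v v'.
Proof.
rewrite /edges_between -[RHS](card_imset _ (@edge_act_inj s)); apply: eq_card => e.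
have [f _ fK] := injF_bij (@edge_act_inj s).
rewrite -[e]fK mem_imset; last exact: edge_act_inj.
rewrite !inE ends_act -[[set av s v; _]]/(_ :|: _) -!imset_set1 -imsetU.
by rewrite (inj_eq (imset_inj (@perm_inj _ (av s)))).
Qed.

Lemma valency_act (s : aut G) (v : vert G) : valency (av s v) = valency v.
Proof.
rewrite /valency -[RHS](card_imset _ (@perm_inj _ (ad s))); apply: eq_card => d.
rewrite -[d](permKV (ad s)) mem_imset; last exact: perm_inj.
by rewrite !inE ad_src (inj_eq perm_inj).
Qed.

Lemma alpha_act (s : aut G) (D : Div G) :
  alpha (Div_act s D) = Div_act s (alpha D).
Proof.
apply/ffunP => v; rewrite !ffunE (reindex_perm (av s)) /=.
apply: eq_bigr => u _; rewrite ffunE permK; congr (_ * _).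
rewrite -[v in LHS](permKV (av s)) /intersection (inj_eq perm_inj).
by rewrite !edges_between_act valency_act.
Qed.

(* Well defined on classes, see Jac_act_pi. *)
Definition Jac_act (s : aut G) (x : Jac G) : Jac G :=
  \pi_(Jac G) (Div0_act s (repr x)).

Lemma Jac_act_pi (s : aut G) (D : Div0 G) :
  Jac_act s (\pi_(Jac G) D) = \pi_(Jac G) (Div0_act s D).
Proof.
apply/eqP; rewrite -idealrBE.
have : (repr (\pi_(Jac G) D) - D) \in Preim (val : Div0 G -> Div G) (Prin G).
  by rewrite idealrBE reprK.
case/asboolP => D' E; apply/asboolP; exists (Div_act s D').
rewrite [RHS]alpha_act -[alpha D']E; apply/ffunP => v.
by rewrite !ffunE.
Qed.

End Aut.

(* hyp_fixed counts the edges at v that iota fixes pointwise, not those that it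
   reverses. *)
Record hyperelliptic (G : graph) (g : vert G -> nat) (iota : aut G) : Prop := {
  hyp_connected : graph_connected G;
  hyp_invol_vert : involutive (av iota);
  hyp_invol_dart : involutive (ad iota);
  hyp_genus : forall v, g v <> 0%N -> av iota v = v;
  hyp_stable : forall v, g v = 0%N -> (3 <= valency v)%N;
  hyp_fixed : forall v,
    (#|[set e : edge G | (v \in ends e) && [forall d in val e, ad iota d == d]]|
       <= 2 * g v + 2)%N;
  hyp_tree : is_tree (quotient_graph iota) }.

(* Metric hyperelliptic graphs all of whose edge lengths are integers. *)
Record integral_hyperelliptic := IntegralHyperelliptic {
  ihgraph :> graph;
  genus_at : vert ihgraph -> nat;
  iota : aut ihgraph;
  len : edge ihgraph -> nat;
  ih_hyperelliptic : hyperelliptic genus_at iota;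
  len_gt0 : forall e, (0 < len e)%N;
  len_iota : forall e, len (edge_act iota e) = len e }.

Definition has_genus (G : integral_hyperelliptic) (n : nat) : Prop :=
  exists2 r, has_rank (H1 G) r & n = (r + \sum_v genus_at (i := G) v)%N.

Record Aut_metric (G : integral_hyperelliptic) := AutMetric {
  aut_of :> aut G;
  aut_genus : forall v, genus_at (av aut_of v) = genus_at v;
  aut_len : forall e, len (edge_act aut_of e) = len e;
  aut_iota_vert :
    forall v, av aut_of (av (iota G) v) = av (iota G) (av aut_of v);
  aut_iota_dart :
    forall d, ad aut_of (ad (iota G) d) = ad (iota G) (ad aut_of d) }.

Definition Phi (G : integral_hyperelliptic) : zmodType :=
  {quot (Im (to_dual (len (i := G))))}.

Section DualAction.
Variable G : integral_hyperelliptic.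

Lemma H1_actD (s : aut G) : {morph H1_act s : x y / x + y}.
Proof. by move=> x y; do 2!apply: val_inj; apply/ffunP => d; rewrite !ffunE. Qed.

Lemma dual_act_subproof (s : aut G) (f : dual (H1 G)) :
  {morph (fun y => val f (H1_act (aut_inv s) y)) : x y / x + y}.
Proof. by case: f => f /= /asboolP fD x y; rewrite H1_actD fD. Qed.

Definition dual_act (s : aut G) (f : dual (H1 G)) : dual (H1 G) :=
  Dual (dual_act_subproof s f).

(* Well defined on classes, see Phi_act_pi. *)
Definition Phi_act (s : Aut_metric G) (x : Phi G) : Phi G :=
  \pi_(Phi G) (dual_act s (repr x)).

Lemma pairing_len_act (s : Aut_metric G) (c c' : C1 G) :
  pairing (len (i := G)) (C1_act s c) c' =
  pairing (len (i := G)) c (C1_act (aut_inv s) c').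
Proof.
have bij : bijective (edge_act s) by apply/injF_bij/edge_act_inj.
rewrite /pairing (reindex _ (onW_bij _ bij)) /=; apply: eq_bigr => e _.
rewrite aut_len; congr (_ * _).
rewrite !ffunE /= invgK.
have [->|->] := orb_reprE (@drev G) (ad s (orb_repr e)).
  by rewrite permK.
by rewrite aut_inv_drev permK !chain_drev mulrNN.
Qed.

Lemma Phi_act_pi (s : Aut_metric G) (f : dual (H1 G)) :
  Phi_act s (\pi_(Phi G) f) = \pi_(Phi G) (dual_act s f).
Proof.
apply/eqP; rewrite -idealrBE.
have : (repr (\pi_(Phi G) f) - f) \in Im (to_dual (len (i := G))).
  by rewrite idealrBE reprK.
case/asboolP => x E; apply/asboolP; exists (H1_act s x).
apply: val_inj; apply: funext => y /=.
rewrite pairing_len_act.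
exact: (congr1 (fun h : dual (H1 G) => val h (H1_act (aut_inv s) y)) E).
Qed.

End DualAction.

Lemma tagged_ordP (T : Type) (n : T -> nat) (p q : {x & 'I_(n x)}) :
  tag p = tag q -> val (tagged p) = val (tagged q) -> p = q.
Proof.
by case: p q => [x i] [y j] /= E; case: _ / E in j * => /val_inj ->.
Qed.

Section Subdivision.
Variable G : integral_hyperelliptic.

Definition dlen (d : dart G) : nat := len (edge_of d).

Lemma dlen_drev (d : dart G) : dlen (drev d) = dlen d.
Proof. by rewrite /dlen edge_of_drev. Qed.

Lemma dlen_act (s : Aut_metric G) (d : dart G) : dlen (ad s d) = dlen d.
Proof. by rewrite /dlen -edge_act_of aut_len. Qed.

(* (d, i) is the point at distance i + 1 from the origin of d; it is identified
   with the same point of the reversed dart. *)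
Definition ipoint : finType := {d : dart G & 'I_(dlen d).-1}.

Definition Ipoint (d : dart G) (i : 'I_(dlen d).-1) : ipoint := Tagged _ i.

Lemma ipoint_rev_subproof (d : dart G) : (dlen d).-1 = (dlen (drev d)).-1.
Proof. by rewrite dlen_drev. Qed.

Definition ipoint_rev (p : ipoint) : ipoint :=
  Tagged _ (cast_ord (ipoint_rev_subproof (tag p)) (rev_ord (tagged p))).

Definition gz_vert : finType := (vert G + orb ipoint_rev)%type.

(* The point at distance i from the origin of d, for i <= dlen d. *)
Definition gz_point (d : dart G) (i : nat) : gz_vert :=
  if i is j.+1 then
    if insub j is Some k
    then inr (orb_of ipoint_rev (@Ipoint d k))
    else inl (tgt d)
  else inl (src d).

(* (d, i) is the unit segment of d from distance i to distance i + 1. *)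
Definition gz_dart : finType := {d : dart G & 'I_(dlen d)}.

Definition gz_src (a : gz_dart) : gz_vert := gz_point (tag a) (tagged a).

Definition gz_drev (a : gz_dart) : gz_dart :=
  Tagged _ (cast_ord (esym (dlen_drev (tag a))) (rev_ord (tagged a))).

Lemma gz_drevK : involutive gz_drev.
Proof.
case=> d i; apply: tagged_ordP => /=; first exact: drevK.
by rewrite dlen_drev subnSK // subKn // ltnW.
Qed.

Lemma gz_drev_neq (a : gz_dart) : gz_drev a != a.
Proof. by apply/eqP => /(congr1 tag) /eqP; apply/negP/drev_neq. Qed.

Definition GZ : graph := Graph gz_src gz_drevK gz_drev_neq.

Definition gz_dart_act (s : Aut_metric G) (a : gz_dart) : gz_dart :=
  Tagged _ (cast_ord (esym (dlen_act s (tag a))) (tagged a)).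

Lemma gz_dart_act_inj s : injective (gz_dart_act s).
Proof.
move=> [d i] [d' i'] E; apply: tagged_ordP => /=.
  by have /perm_inj := congr1 tag E.
exact: (congr1 (fun a : gz_dart => val (tagged a)) E).
Qed.

Lemma ipoint_act_subproof (s : Aut_metric G) (d : dart G) :
  (dlen d).-1 = (dlen (ad s d)).-1.
Proof. by rewrite dlen_act. Qed.

Definition ipoint_act (s : Aut_metric G) (p : ipoint) : ipoint :=
  Tagged _ (cast_ord (ipoint_act_subproof s (tag p)) (tagged p)).

Lemma ipoint_act_inj s : injective (ipoint_act s).
Proof.
move=> [d i] [d' i'] E; apply: tagged_ordP => /=.
  by have /perm_inj := congr1 tag E.
exact: (congr1 (fun a : ipoint => val (tagged a)) E).
Qed.

Lemma ipoint_revK : involutive ipoint_rev.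
Proof.
case=> d i; apply: tagged_ordP => /=; first exact: drevK.
by rewrite dlen_drev subnSK // subKn // ltnW.
Qed.

Lemma ipoint_act_rev s p :
  ipoint_act s (ipoint_rev p) = ipoint_rev (ipoint_act s p).
Proof.
case: p => d i; apply: tagged_ordP => /=; first exact: ad_drev.
by rewrite dlen_act.
Qed.

Definition gz_vert_act (s : Aut_metric G) (v : gz_vert) : gz_vert :=
  match v with
  | inl v => inl (av s v)
  | inr A => inr (orb_of ipoint_rev (ipoint_act s (orb_repr A)))
  end.

Lemma gz_vert_act_inj s : injective (gz_vert_act s).
Proof.
case=> [v|A] [v'|A'] //= [] E; first by rewrite (perm_inj E).
congr inr; rewrite -[A](orb_ofK ipoint_revK) -[A'](orb_ofK ipoint_revK).
apply/(orb_ofE ipoint_revK).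
have /(orb_ofE ipoint_revK)[|] :
  orb_of ipoint_rev (ipoint_act s (orb_repr A)) =
  orb_of ipoint_rev (ipoint_act s (orb_repr A')) by exact: val_inj.
  by move/ipoint_act_inj; left.
by rewrite -ipoint_act_rev => /ipoint_act_inj; right.
Qed.

Lemma gz_point_act (s : Aut_metric G) (d : dart G) (i : nat) :
  gz_point (ad s d) i = gz_vert_act s (gz_point d i).
Proof.
case: i => [|j] /=; first by rewrite ad_src.
case: insubP => [k kj Ek|kj]; case: insubP => [k' kj' Ek'|kj'] /=.
- congr inr; apply/(orb_ofE ipoint_revK).
  have kk : Ipoint k = ipoint_act s (Ipoint k').
    by apply: tagged_ordP => //=; rewrite Ek Ek'.
  rewrite kk.
  have [->|->] := orb_reprE ipoint_rev (Ipoint k').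
    by left.
  by right; rewrite ipoint_act_rev ipoint_revK.
- by move: kj kj'; rewrite dlen_act => ->.
- by move: kj kj'; rewrite dlen_act => /negbTE ->.
- by rewrite /tgt -ad_drev ad_src.
Qed.

Definition gz_vert_perm (s : Aut_metric G) : {perm vert GZ} :=
  perm (@gz_vert_act_inj s).

Definition gz_dart_perm (s : Aut_metric G) : {perm dart GZ} :=
  perm (@gz_dart_act_inj s).

Lemma gz_aut_src (s : Aut_metric G) (a : dart GZ) :
  src (gz_dart_perm s a) = gz_vert_perm s (src a).
Proof. by rewrite !permE /= /gz_src gz_point_act. Qed.

Lemma gz_aut_drev (s : Aut_metric G) (a : dart GZ) :
  gz_dart_perm s (drev a) = drev (gz_dart_perm s a).
Proof.
rewrite !permE; apply: tagged_ordP => /=; first exact: ad_drev.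
by rewrite dlen_act.
Qed.

Lemma gz_point_drev (d : dart G) (i : nat) :
  (i <= dlen d)%N -> gz_point (drev d) (dlen d - i) = gz_point d i.
Proof.
case: i => [|j] jd; first rewrite subn0.
  rewrite /gz_point (_ : dlen d = (dlen d).-1.+1); last first.
    by rewrite prednK // len_gt0.
  by rewrite insubF /tgt ?drevK // dlen_drev ltnn.
case: (ltnP j (dlen d).-1) => [jl|lj]; last first.
  have -> : j = (dlen d).-1.
    by apply/eqP; rewrite eqn_leq lj -ltnS prednK ?len_gt0 ?andbT.
  rewrite [in LHS]prednK ?len_gt0 // subnn /=.
  by rewrite insubF // ltnn.
have -> : (dlen d - j.+1 = ((dlen d).-1 - j.+1).+1)%N.
  by rewrite -subSn // prednK ?len_gt0.
have jr : ((dlen d).-1 - j.+1 < (dlen (drev d)).-1)%N.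
  by rewrite dlen_drev -subSn // subSS leq_subr.
rewrite /gz_point (insubT (fun k => k < _)%N jr) (insubT (fun k => k < _)%N jl) /=.
by congr inr; apply/(orb_ofE ipoint_revK); right; apply: tagged_ordP.
Qed.

Lemma gz_tgt (a : dart GZ) : tgt a = gz_point (tag a) (tagged a).+1.
Proof. by rewrite -gz_point_drev. Qed.

Definition GZ_aut (s : Aut_metric G) : aut GZ :=
  Aut (gz_aut_src s) (gz_aut_drev s).

(* The chain c of G_Z defines the functional on H_1(G) = H_1(G_Z) given by the
   pairing of G_Z with unit lengths: a cycle y of G takes the value y d on each
   unit segment of the dart d. *)
Definition restrict_pairing (c : C1 GZ) (y : H1 G) : int :=
  \sum_(e : edge GZ) val c (orb_repr e) * val (val y) (tag (orb_repr e)).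

Lemma restrict_pairingD (c : C1 GZ) : {morph restrict_pairing c : x y / x + y}.
Proof.
move=> x y; rewrite /restrict_pairing -big_split /=.
by apply: eq_bigr => e _; rewrite ffunE mulrDr.
Qed.

Definition functional (c : C1 GZ) : dual (H1 G) := Dual (restrict_pairingD c).

End Subdivision.

(* Main.v *)
Require Import Defs.
From HB Require Import structures.
From mathcomp Require Import all_fingroup all_boot all_order all_algebra.
From mathcomp Require Import boolp functions.

Set Implicit Arguments.
Unset Strict Implicit.
Unset Printing Implicit Defensive.

Import GRing.Theory.
Local Open Scope ring_scope.
Local Open Scope quotient_scope.

(** The isomorphism sends the class of the divisor [bdry c], for a 1-chain [c]
of the subdivided graph GZ, to the class of the functional [<c, ->] on cycles.
Only the connectedness of G matters; the rest is discrete Hodge theory on GZ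
with its edges of length 1.

The pairing turns the boundary map into its transpose, the coboundary map
[cobdry], which sends a divisor D to the chain a |-> D (tgt a) - D (src a)
([upairing_cobdry]), and the Laplacian [alpha] is [bdry] after [cobdry]
([alphaE]).  In particular coboundaries pair to zero with cycles.

On a connected graph choose for each vertex v a chain p v with boundary
v - v0.  Extending p linearly to divisors gives a section [fill] of [bdry] over
the divisors of degree 0, hence an additive retraction c - fill (bdry c) of
chains onto cycles.  No spanning tree is needed.  It follows that
- a chain orthogonal to all cycles is the coboundary of its potential
  v |-> <c, p v> ([cobdry_potential]);
- every functional on cycles extends to chains, and is therefore the pairing
  with some chain ([upairing_repr], [functional_surj]).

Cycles of GZ are the subdivisions of cycles of G, because a cycle takes equal
values on the consecutive unit segments of an edge ([cycle_subdivide]), and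
the functional of a subdivided cycle y is [to_dual len y]
([functional_subdivide]).  Consequently [bdry c] is principal iff c is a
coboundary plus a cycle, iff [<c, ->] comes from a cycle of G
([functional_Prin]).  One direction makes the map well defined and the other
makes it injective; surjectivity is [functional_surj]. *)

(** * Sums and integers *)

Lemma sum_delta (T : finType) (P : pred T) (a : T) :
  \sum_(d | P d) (d == a)%:R = (P a)%:R :> int.
Proof.
rewrite big_mkcond (bigD1 a) //= eqxx big1 ?addr0; first by case: (P a).
by move=> d /negbTE ->; case: ifP.
Qed.

Lemma sum_mul_delta (T : finType) (F : T -> int) (a : T) :
  \sum_d F d * (d == a)%:R = F a.
Proof.
rewrite (bigD1 a) //= eqxx mulr1 big1 ?addr0 // => d /negbTE ->.
exact: mulr0.
Qed.

Lemma int_double_inj : injective (fun x : int => x *+ 2).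
Proof.
move=> x y /eqP; rewrite -subr_eq0 -mulrnBl Num.Theory.mulrn_eq0 subr_eq0.
by move/eqP.
Qed.

Lemma eq_set2 (T : finType) (a b u v : T) :
  ([set a; b] == [set u; v]) = (a == u) && (b == v) || (a == v) && (b == u).
Proof.
apply/eqP/idP => [/setP E|/orP[]/andP[/eqP-> /eqP->]]; rewrite // 1?setUC //.
have := E a; have := E b; have := E u; have := E v; rewrite !inE !eqxx !orbT /=.
rewrite !(eq_sym u) !(eq_sym v).
by do 4?case: (_ == _).
Qed.

(** * Chains, coboundaries and the Laplacian of a graph *)

Section Chains.
Variable G : graph.
Implicit Types (c : C1 G) (D : Div G) (a d : dart G) (v : vert G).

Lemma tgt_drev d : tgt (drev d) = src d.
Proof. by rewrite /tgt drevK. Qed.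

Lemma sum_drev (F : dart G -> int) : \sum_d F (drev d) = \sum_d F d.
Proof. by rewrite [RHS](reindex_inj (can_inj (@drevK G))). Qed.

Lemma edge_ofE d d' : (edge_of d == edge_of d') = (d == d') || (d == drev d').
Proof.
apply/eqP/orP.
  by move/(orb_ofE (@drevK G)); case=> ->; rewrite eqxx; auto.
by move=> E; apply/(orb_ofE (@drevK G)); case: E => /eqP; auto.
Qed.

Lemma edge_reprE (e : edge G) d :
  (edge_of d == e) = (d == orb_repr e) || (d == drev (orb_repr e)).
Proof. by rewrite -[in LHS](orb_ofK (@drevK G) e) edge_ofE. Qed.

(** Sums over edges are defined through a choice of orientations; up to a factor
    2 they are sums over darts, which need no choice. *)
Lemma sum_edge (F : dart G -> int) : (forall d, F (drev d) = F d) ->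
  \sum_d F d = (\sum_(e : edge G) F (orb_repr e)) *+ 2.
Proof.
move=> FE; rewrite (partition_big (@edge_of G) xpredT) //= -sumrMnl.
apply: eq_bigr => e _; have nE := drev_neq (orb_repr e).
rewrite (bigD1 (orb_repr e)) ?edge_reprE ?eqxx //=.
rewrite (bigD1 (drev (orb_repr e))) ?edge_reprE ?eqxx ?orbT //=.
rewrite big1 ?addr0 ?FE // => d; rewrite edge_reprE.
by case: eqP => //= _; case: eqP.
Qed.

Lemma pairing_darts (w : edge G -> nat) c c' :
  pairing w c c' *+ 2 = \sum_d (w (edge_of d))%:Z * (val c d * val c' d).
Proof.
rewrite sum_edge => [|d]; last by rewrite edge_of_drev !chain_drev mulrNN.
by congr (_ *+ 2); apply: eq_bigr => e _; rewrite /edge_of (orb_ofK (@drevK G)).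
Qed.

(** The pairing of chains for which all edges have length 1. *)
Definition upairing : C1 G -> C1 G -> int := pairing (fun=> 1%N).

Lemma upairing_darts c c' : upairing c c' *+ 2 = \sum_d val c d * val c' d.
Proof. by rewrite pairing_darts; apply: eq_bigr => d _; rewrite mul1r. Qed.

(** The vertex v as a divisor. *)
Definition vdelta v : Div G := [ffun u => (u == v)%:R].

Lemma dart_chain_subproof a :
  symm [ffun d => (d == a)%:R - (d == drev a)%:R] = 0.
Proof.
apply/ffunP => d; rewrite !ffunE (can2_eq (@drevK G) (@drevK G)).
by rewrite (inj_eq (can_inj (@drevK G))) addrA subrK subrr.
Qed.

(** The dart a as a 1-chain: 1 at a and -1 at its reverse. *)
Definition dart_chain a : C1 G := inKer (dart_chain_subproof a).

Lemma bdry_dart_chain a : bdry (dart_chain a) = vdelta (tgt a) - vdelta (src a).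
Proof.
apply/ffunP => v; rewrite !ffunE -(tgt_drev a) !(eq_sym v).
pose P d := tgt d == v; rewrite -(sum_delta P) -(sum_delta P (drev a)).
by rewrite -sumrB; apply: eq_bigr => d _; rewrite ffunE.
Qed.

Lemma upairing_dart_chain c a : upairing c (dart_chain a) = val c a.
Proof.
apply: int_double_inj; rewrite upairing_darts.
under eq_bigr do rewrite ffunE mulrBr.
by rewrite sumrB !sum_mul_delta chain_drev opprK.
Qed.

(** The darts generate the chains; each edge of c is counted in both
    orientations. *)
Lemma chain_double c : c *+ 2 = \sum_d dart_chain d *~ val c d.
Proof.
apply: val_inj; apply/ffunP => b; rewrite raddf_sum sum_ffunE.
transitivity (val c b + val c b); first by rewrite !ffunE.
under eq_bigr => d _.
  rewrite raddfMz ffunMzE /= ffunE -mulrzr intz mulrC mulrBr.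
over.
rewrite sumrB.
under eq_bigr do rewrite eq_sym; rewrite sum_mul_delta; congr (_ + _).
under eq_bigr do rewrite eq_sym (can2_eq (@drevK G) (@drevK G)).
by rewrite sum_mul_delta -[sval c]/(val c) chain_drev opprK.
Qed.

Lemma cobdry_subproof D : symm [ffun d => D (tgt d) - D (src d)] = 0.
Proof.
by apply/ffunP => d; rewrite !ffunE tgt_drev -/(tgt d) addrA subrK subrr.
Qed.

(** The coboundary of D, seen as a function on vertices. *)
Definition cobdry D : C1 G := inKer (cobdry_subproof D).

(** The coboundary is adjoint to the boundary. *)
Lemma upairing_cobdry D c : upairing (cobdry D) c = \sum_v D v * bdry c v.
Proof.
apply: int_double_inj; rewrite upairing_darts mulr2n.
have -> : \sum_v D v * bdry c v = \sum_d D (tgt d) * val c d.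
  rewrite [RHS](partition_big (@tgt G) xpredT) //=.
  apply: eq_bigr => v _; rewrite ffunE mulr_sumr.
  by apply: eq_bigr => d /eqP ->.
rewrite -[in X in _ = _ + X]sum_drev -big_split /=; apply: eq_bigr => d _.
by rewrite ffunE tgt_drev chain_drev mulrBl mulrN.
Qed.

Lemma ends_edge_of d : ends (edge_of d) = [set src d; tgt d].
Proof. by rewrite /ends /= imsetU !imset_set1. Qed.

Lemma edges_between_darts v v' :
  (edges_between v v')%:Z *+ 2 =
  \sum_d ([set src d; tgt d] == [set v; v'])%:R.
Proof.
rewrite sum_edge => [|d]; last by rewrite tgt_drev setUC.
congr (_ *+ 2); rewrite /edges_between -sum1_card -natz natr_sum big_mkcond /=.
apply: eq_bigr => e _; rewrite inE -ends_edge_of.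
by rewrite /edge_of (orb_ofK (@drevK G)); case: ifP.
Qed.

Lemma intersectionE u v :
  intersection u v =
  (valency v)%:Z * (v == u)%:R - \sum_(d | tgt d == v) (src d == u)%:R.
Proof.
(* The darts with ends {u, v} are those from u to v together with those from v
   to u; these coincide if u = v and are disjoint otherwise. *)
have E := edges_between_darts u v; rewrite big_mkcond /=.
rewrite /intersection eq_sym; move: E; case: eqVneq => [-> E|nuv E].
  rewrite mulr1 mul2n -addnn PoszD -mulr2n E; congr (_ - _).
  by apply: eq_bigr => d _; rewrite eq_set2 andbC orbb; case: eqP.
rewrite mulr0 sub0r; congr (- _); apply: int_double_inj; rewrite E mulr2n.
rewrite -[in X in _ = _ + X]sum_drev -big_split /=; apply: eq_bigr => d _.
rewrite eq_set2 tgt_drev -/(tgt d).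
have [->|_] := eqVneq (src d) v; have [->|_] := eqVneq (tgt d) v;
  by rewrite ?(negbTE nuv) ?andbF ?orbF ?addr0 ?add0r ?andbT.
Qed.

(** The Laplacian is the boundary of the coboundary. *)
Lemma alphaE D : alpha D = bdry (cobdry D).
Proof.
apply/ffunP => v; rewrite !ffunE.
under eq_bigr do rewrite intersectionE mulrBr mulrCA eq_sym mulr_sumr.
rewrite sumrB -mulr_sumr sum_mul_delta exchange_big /=.
under [RHS]eq_bigr => d /eqP E do rewrite ffunE E.
rewrite sumrB; congr (_ - _); last first.
  apply: eq_bigr => d _; rewrite -[RHS](sum_mul_delta D).
  by apply: eq_bigr => u _; rewrite eq_sym.
rewrite sumr_const -mulr_natl natz; congr (_%:Z * _).
rewrite /valency -(card_imset _ (can_inj (@drevK G))); apply: eq_card => d.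
by rewrite -[d in LHS](drevK d) mem_imset ?inE //; apply: can_inj (@drevK G).
Qed.

Lemma degree_bdry c : degree (bdry c) = 0.
Proof.
(* The degree is the pairing with the coboundary of a constant function. *)
have := upairing_cobdry [ffun=> 1] c; under eq_bigr do rewrite ffunE mul1r.
rewrite /degree => <-; apply: int_double_inj; rewrite upairing_darts mul0rn.
by rewrite big1 // => d _; rewrite !ffunE subrr mul0r.
Qed.

Lemma upairing_cobdry_cycle D c : bdry c = 0 -> upairing (cobdry D) c = 0.
Proof.
by move=> c0; rewrite upairing_cobdry c0 big1 // => v _; rewrite ffunE mulr0.
Qed.

Fact upairing_additive c : zmod_morphism (upairing c).
Proof.
by move=> x y; apply/eqP; rewrite eq_sym subr_eq /upairing -pairingDr subrK.
Qed.

HB.instance Definition _ c :=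
  GRing.isZmodMorphism.Build _ _ (upairing c) (upairing_additive c).

(** Every linear form on 1-chains is the pairing with a chain. *)
Lemma upairing_repr (F : C1 G -> int) : zmod_morphism F ->
  exists c, forall x, F x = upairing c x.
Proof.
move=> FB; pose mF := GRing.isZmodMorphism.Build _ _ F FB.
pose f : {additive C1 G -> int} := HB.pack F mF.
have cP : symm [ffun d => f (dart_chain d)] = 0.
  apply/ffunP => d; rewrite !ffunE -raddfD -[RHS](raddf0 f); congr (f _).
  apply: val_inj; apply/ffunP => b; rewrite !ffunE drevK.
  by rewrite addrC addrA subrK subrr.
exists (inKer cP) => x; apply: int_double_inj; rewrite -[F]/(f : _ -> _).
rewrite -raddfMn chain_double raddf_sum upairing_darts.
by apply: eq_bigr => d _; rewrite raddfMz ffunE mulrC -mulrzr intz mulrC.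
Qed.

(** * Fillings of divisors of degree 0 *)

Section Filling.
Variable p : vert G -> C1 G.

(** The linear extension of p to divisors. *)
Definition fill D : C1 G := \sum_v p v *~ D v.

Fact fill_additive : zmod_morphism fill.
Proof.
move=> D D'; rewrite /fill -sumrB; apply: eq_bigr => v _.
by rewrite !ffunE mulrzBr.
Qed.

HB.instance Definition _ := GRing.isZmodMorphism.Build _ _ fill fill_additive.

Lemma fill_vdelta v : fill (vdelta v) = p v.
Proof.
rewrite /fill (bigD1 v) //= ffunE eqxx mulr1z big1 ?addr0 // => u /negbTE nuv.
by rewrite ffunE nuv mulr0z.
Qed.

Variable v0 : vert G.
Hypothesis bdry_p : forall v, bdry (p v) = vdelta v - vdelta v0.

(** [fill] is a section of the boundary map over the divisors of degree 0. *)
Lemma bdry_fill D : degree D = 0 -> bdry (fill D) = D.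
Proof.
move=> D0; apply/ffunP => u; rewrite raddf_sum sum_ffunE.
under eq_bigr => v _.
  rewrite raddfMz /= bdry_p ffunMzE !ffunE eq_sym -mulrzr intz mulrC mulrBr.
over.
by rewrite sumrB sum_mul_delta -mulr_suml -/(degree D) D0 mul0r subr0.
Qed.

(** The chain [c - fill (bdry c)] is a cycle; it is c itself if c is one. *)
Lemma fill_cycle c : bdry (c - fill (bdry c)) = 0.
Proof. by rewrite raddfB /= bdry_fill ?subrr // degree_bdry. Qed.

(** A chain orthogonal to all cycles is a coboundary. *)
Lemma cobdry_potential c : (forall x, bdry x = 0 -> upairing c x = 0) ->
  c = cobdry [ffun v => upairing c (p v)].
Proof.
move=> cP; apply: val_inj; apply/ffunP => a; rewrite !ffunE.
(* The dart a, completed to a cycle through v0 by the chains p. *)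
have := cP _ (fill_cycle (dart_chain a)).
rewrite raddfB /= upairing_dart_chain bdry_dart_chain [fill _]raddfB /=.
rewrite !fill_vdelta raddfB /=.
by move/subr0_eq.
Qed.

End Filling.

Lemma connect_chain u v : connect (@adj G) u v ->
  exists c, bdry c = vdelta v - vdelta u.
Proof.
case/connectP => p; elim: p u => [|w p IH] u /=.
  by move=> _ ->; exists 0; rewrite raddf0 subrr.
case/andP => /existsP[d /andP[/eqP <- /eqP <-]] /IH{}IH /IH[c cE].
by exists (c + dart_chain d); rewrite raddfD /= cE bdry_dart_chain addrA subrK.
Qed.

End Chains.

(** * Cycles of the subdivided graph *)

Section Subdivision.
Variable G : integral_hyperelliptic.
Implicit Types (c : C1 G) (d : dart G) (a : dart (GZ G)) (x : C1 (GZ G)).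

Lemma dlen_gt0 d : (0 < dlen d)%N.
Proof. exact: len_gt0. Qed.

(** The unit segment of d from distance i to distance i + 1. *)
Definition segment d i (h : (i < dlen d)%N) : dart (GZ G) :=
  Tagged (fun d => 'I_(dlen d)) (Ordinal h).

Lemma sum_segments (F : dart (GZ G) -> int) :
  \sum_a F a = \sum_d \sum_(i < dlen d) F (Tagged _ i).
Proof. by rewrite sig_big_dep; apply: eq_bigr => -[]. Qed.

Lemma subdivide_subproof c : symm [ffun a : dart (GZ G) => val c (tag a)] = 0.
Proof. by apply/ffunP => a; rewrite !ffunE chain_drev subrr. Qed.

(** A chain of G seen as a chain of GZ: it takes on each unit segment of d the
    value of c at d. *)
Definition subdivide c : C1 (GZ G) := inKer (subdivide_subproof c).

Lemma gz_point_dlen d : gz_point d (dlen d) = inl (tgt d).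
Proof. by rewrite -gz_point_drev // subnn. Qed.

(** The boundary of [subdivide c] is that of c, supported on the vertices of G:
    evaluated on a function on vertices, both are a pairing with a coboundary,
    and the differences along an edge telescope. *)
Lemma bdry_subdivide c w :
  bdry (subdivide c) w = \sum_v (inl v == w)%:R * bdry c v.
Proof.
have := upairing_cobdry [ffun v => (inl v == w)%:R] c.
under eq_bigr do rewrite ffunE.
move<-; rewrite -[LHS](sum_mul_delta (bdry (subdivide c)) w).
under eq_bigr => v _ do rewrite mulrC -[_%:R](ffunE (fun v => (v == w)%:R)).
rewrite -upairing_cobdry; apply: int_double_inj.
rewrite !upairing_darts sum_segments; apply: eq_bigr => d _.
pose f i : int := (gz_point d i == w)%:R.
transitivity (\sum_(i < dlen d) (f i.+1 - f i) * val c d).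
  by apply: eq_bigr => i _; rewrite !ffunE gz_tgt.
rewrite -mulr_suml -(big_mkord xpredT (fun i => f i.+1 - f i)).
by rewrite telescope_sumr // /f gz_point_dlen !ffunE.
Qed.

Lemma gz_point_interior d j (h : (j < (dlen d).-1)%N) :
  gz_point d j.+1 = inr (orb_of (@ipoint_rev G) (Ipoint (Ordinal h))).
Proof. by rewrite /gz_point insubT. Qed.

(** Exactly two darts of GZ end at an interior point of an edge. *)
Lemma tgt_interior d j (h : (j < dlen d)%N) (h' : (j.+1 < dlen d)%N) a :
  (tgt a == gz_point d j.+1) = (a == segment h) || (a == drev (segment h')).
Proof.
have hj : (j < (dlen d).-1)%N by rewrite -ltnS prednK ?dlen_gt0.
apply/eqP/orP => [|[]/eqP->]; [|by rewrite gz_tgt|by rewrite tgt_drev].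
rewrite gz_tgt (gz_point_interior hj); case: a => d' i /=.
case: insubP => // k kj Ek [] E.
have /(orb_ofE (@ipoint_revK G))[|] :
    orb_of (@ipoint_rev G) (Ipoint k) =
    orb_of (@ipoint_rev G) (Ipoint (Ordinal hj)).
- exact: val_inj.
- move=> E'; left; apply/eqP; apply: tagged_ordP => /=.
    exact: (congr1 tag E').
  by rewrite -Ek; exact: (congr1 (fun a : ipoint G => val (tagged a)) E').
- move=> E'; right; apply/eqP; apply: tagged_ordP => /=.
    exact: (congr1 tag E').
  rewrite -Ek [LHS](congr1 (fun a : ipoint G => val (tagged a)) E') /=.
  by rewrite -subn1 -subnDA add1n.
Qed.

Lemma bdry_interior x d j (h : (j < dlen d)%N) (h' : (j.+1 < dlen d)%N) :
  bdry x (gz_point d j.+1) = val x (segment h) - val x (segment h').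
Proof.
rewrite ffunE -chain_drev.
have nE : drev (segment h') != segment h.
  by apply/eqP => /(congr1 tag)/eqP; apply/negP/drev_neq.
rewrite (bigD1 (segment h)) ?(tgt_interior h h') ?eqxx //=.
rewrite (bigD1 (drev (segment h'))) ?(tgt_interior h h') ?eqxx ?orbT //=.
rewrite big1 ?addr0 // => a; rewrite (tgt_interior h h').
by case: eqP => //= _; case: eqP.
Qed.

Lemma cycle_segment x d i (h : (i < dlen d)%N) : bdry x = 0 ->
  val x (segment h) = val x (segment (dlen_gt0 d)).
Proof.
move=> x0; elim: i h => [|i IH] h.
  by congr (val x (segment _)); apply: bool_irrelevance.
rewrite -(IH (ltnW h)); apply/esym/subr0_eq; rewrite -bdry_interior x0.
by rewrite ffunE.
Qed.

(** Every cycle of GZ is the subdivision of a cycle of G. *)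
Lemma cycle_subdivide x : bdry x = 0 -> exists y : H1 G, x = subdivide (val y).
Proof.
move=> x0.
have xE (a : dart (GZ G)) : val x (segment (dlen_gt0 (tag a))) = val x a.
  by case: a => d [i h]; rewrite -(cycle_segment h).
have yP : symm [ffun d => val x (segment (dlen_gt0 d))] = 0.
  apply/ffunP => d; rewrite !ffunE -[val x (segment _)]opprK -chain_drev.
  by rewrite -(xE (drev _)) addrC subrr.
pose y := inKer yP.
have yE : x = subdivide y.
  by apply: val_inj; apply/ffunP => a; rewrite !ffunE -xE.
suff y0 : bdry y = 0 by exists (inKer y0).
apply/ffunP => v.
rewrite [RHS]ffunE -[LHS](sum_mul_delta (bdry y)).
rewrite -[RHS](ffunE (fun=> 0) (inl v : vert (GZ G))).
rewrite -[[ffun=> 0]]x0 yE bdry_subdivide.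
by apply: eq_bigr => u _; rewrite mulrC.
Qed.

Lemma bdry_subdivide_H1 (y : H1 G) : bdry (subdivide (val y)) = 0.
Proof.
apply/ffunP => w; rewrite bdry_subdivide ffunE; case: y => y /= /eqP ->.
by rewrite big1 // => v _; rewrite ffunE mulr0.
Qed.

Lemma GZ_connect :
  exists v0 : vert (GZ G), forall v, connect (@adj (GZ G)) v0 v.
Proof.
have [/card_gt0P[v0 _] conG] := hyp_connected (ih_hyperelliptic G).
exists (inl v0).
(* The unit segments of d lead from its source to each of its points. *)
have along d i :
    (i <= dlen d)%N -> connect (@adj (GZ G)) (inl (src d)) (gz_point d i).
  elim: i => [|i IH] h; first exact: connect0.
  apply: connect_trans (IH (ltnW h)) (connect1 _).
  by apply/existsP; exists (segment h); rewrite gz_tgt !eqxx.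
have old v : connect (@adj (GZ G)) (inl v0) (inl v).
  case/connectP: (conG v0 v) => q + ->; elim/last_ind: q => [|q u IH].
    by move=> _; apply: connect0.
  rewrite rcons_path last_rcons => /andP[/IH{}IH].
  case/existsP=> d /andP[/eqP E /eqP <-].
  by apply: connect_trans IH _; rewrite -E -gz_point_dlen; apply: along.
case=> [v|A]; first exact: old.
rewrite -[A](orb_ofK (@ipoint_revK G)); case: (orb_repr A) => d [k h].
rewrite -[inr _](gz_point_interior h); apply: connect_trans (old (src d)) _.
by apply: along; rewrite -[dlen d]prednK ?dlen_gt0 // ltnW.
Qed.

Lemma subdivide_inj : injective subdivide.
Proof.
move=> c c' /(congr1 val)/ffunP E; apply: val_inj; apply/ffunP => d.
by have := E (segment (dlen_gt0 d)); rewrite !ffunE.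
Qed.

Fact subdivide_additive : zmod_morphism subdivide.
Proof. by move=> c c'; apply: val_inj; apply/ffunP => a; rewrite !ffunE. Qed.

HB.instance Definition _ :=
  GRing.isZmodMorphism.Build _ _ subdivide subdivide_additive.

(** * The functional of a chain *)

Lemma functionalE x (y : H1 G) :
  val (functional x) y = upairing x (subdivide (val y)).
Proof. by apply: eq_bigr => e _; rewrite mul1r ffunE. Qed.

Lemma functional_darts x (y : H1 G) :
  val (functional x) y *+ 2 = \sum_a val x a * val (val y) (tag a).
Proof.
by rewrite functionalE upairing_darts; apply: eq_bigr => a _; rewrite ffunE.
Qed.

Fact functional_additive : zmod_morphism (@functional G).
Proof.
move=> x y; apply: val_inj; apply: funext => z.
by rewrite functionalE /upairing pairingBl -!/(upairing _ _) -!functionalE.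
Qed.

HB.instance Definition _ :=
  GRing.isZmodMorphism.Build _ _ (@functional G) functional_additive.

Lemma functional_subdivide (y : H1 G) :
  functional (subdivide (val y)) = to_dual (len (i := G)) y.
Proof.
apply: val_inj; apply: funext => z; apply: int_double_inj.
rewrite functional_darts [RHS]pairing_darts sum_segments.
apply: eq_bigr => d _; under eq_bigr do rewrite ffunE /=.
by rewrite sumr_const card_ord -mulr_natl natz.
Qed.

Lemma functional_act (s : Aut_metric G) x :
  functional (C1_act (GZ_aut s) x) = dual_act s (functional x).
Proof.
apply: val_inj; apply: funext => y; apply: int_double_inj.
rewrite [RHS]functional_darts functional_darts.
rewrite (reindex_perm (gz_dart_perm s)) /=.
by apply: eq_bigr => a _; rewrite !ffunE permK permE /= invgK.
Qed.

Section Filling.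
Variables (p : vert (GZ G) -> C1 (GZ G)) (v0 : vert (GZ G)).
Hypothesis bdry_p : forall v, bdry (p v) = vdelta v - vdelta v0.

(** [bdry x] is principal iff x is the sum of a coboundary and a cycle. *)
Lemma functional_Prin x :
  (bdry x \in Prin (GZ G)) = (functional x \in Im (to_dual (len (i := G)))).
Proof.
apply/asboolP/asboolP => [[D]|[y E]].
  (* x is a coboundary plus a cycle, and coboundaries have zero functional. *)
  rewrite /= alphaE => xD.
  have /cycle_subdivide[y E] : bdry (x - cobdry D) = 0.
    by rewrite raddfB /= xD subrr.
  exists y; rewrite -functional_subdivide -E raddfB /=.
  rewrite [X in _ = _ - X](_ : _ = 0) ?subr0 //.
  apply: val_inj; apply: funext => z; apply: etrans (functionalE _ _) _.
  by rewrite upairing_cobdry_cycle // bdry_subdivide_H1.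
(* Conversely x differs from a cycle by a chain orthogonal to all cycles. *)
have E0 : functional (x - subdivide (val y)) = 0.
  by rewrite raddfB /= E functional_subdivide subrr.
have /(cobdry_potential bdry_p) :
    forall z, bdry z = 0 -> upairing (x - subdivide (val y)) z = 0.
  by move=> _ /cycle_subdivide[z ->]; rewrite -functionalE E0.
set D := [ffun _ => _] => ED; exists D; rewrite /= alphaE -ED raddfB /=.
by rewrite bdry_subdivide_H1 subr0.
Qed.

Lemma functional_surj (f : dual (H1 G)) : exists x, f = functional x.
Proof.
(* r is an additive retraction of the chains of GZ onto the cycles of G; f
   composed with r is defined on all chains. *)
have /choice[r rE] x :
    exists y : H1 G, x - fill p (bdry x) = subdivide (val y).
  exact: cycle_subdivide (fill_cycle bdry_p x).
have rB : zmod_morphism r.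
  move=> x y; apply: val_inj; apply: subdivide_inj.
  rewrite -rE [RHS]raddfB /= -!rE [bdry _]raddfB /= [fill _ _]raddfB /=.
  by rewrite !opprD !opprK addrACA.
have fD := valP f; rewrite /= /addp in fD; move/asboolP in fD.
have fB : zmod_morphism (val f).
  by move=> y z; apply/eqP; rewrite eq_sym subr_eq -fD subrK.
have [x xE] : exists x, forall z, val f (r z) = upairing x z.
  by apply: upairing_repr => y z; rewrite rB fB.
exists x; apply: val_inj; apply: funext => y; rewrite functionalE -xE.
congr (val f _); apply: val_inj; apply: subdivide_inj.
by rewrite -rE bdry_subdivide_H1 raddf0 subr0.
Qed.

End Filling.
End Subdivision.

(** * The isomorphism *)

Theorem proposition7p10 (G : integral_hyperelliptic) (n : nat) :
  has_genus G n -> (2 <= n)%N ->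
  exists phi : {additive Jac (GZ G) -> Phi G},
    [/\ bijective phi,
        forall (s : Aut_metric G) (x : Jac (GZ G)),
          phi (Jac_act (GZ_aut s) x) = Phi_act s (phi x)
      & (* phi is the canonical map [bdry c] |-> [<c, ->] *)
        forall (c : C1 (GZ G)) (D : Div0 (GZ G)), val D = bdry c ->
          phi (\pi_(Jac (GZ G)) D) = \pi_(Phi G) (functional c)].
Proof.
move=> _ _; have [v0 conG] := GZ_connect G.
have /choice[p bdry_p] v := connect_chain (conG v).
pose phi (x : Jac (GZ G)) : Phi G :=
  \pi_(Phi G) (functional (fill p (val (repr x)))).
have fillK (D : Div0 (GZ G)) : bdry (fill p (val D)) = val D.
  by apply: bdry_fill => //; apply/eqP; apply: (valP D).
have phiE c (D : Div0 (GZ G)) : val D = bdry c ->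
    phi (\pi_(Jac (GZ G)) D) = \pi_(Phi G) (functional c).
  move=> Dc; apply/eqP; rewrite -Quotient.idealrBE -raddfB.
  rewrite -(functional_Prin bdry_p) raddfB /= fillK -Dc -raddfB.
  have : (repr (\pi_(Jac (GZ G)) D) - D)
      \in Preim (val : Div0 (GZ G) -> Div (GZ G)) (Prin (GZ G)).
    by rewrite Quotient.idealrBE reprK.
  by [].
have classP x : exists c,
    exists2 D : Div0 (GZ G), val D = bdry c & x = \pi_(Jac (GZ G)) D.
  by exists (fill p (val (repr x))), (repr x); rewrite ?fillK ?reprK.
have phiB : zmod_morphism phi.
  move=> x y; have [c [D Dc ->]] := classP x; have [c' [D' Dc' ->]] := classP y.
  rewrite (phiE c D) // (phiE c' D') //.
  rewrite -[_ - _](raddfB (\pi_(Jac (GZ G)))).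
  rewrite (phiE (c - c') (D - D')) ?raddfB //.
  by rewrite /= Dc Dc'.
pose mphi := GRing.isZmodMorphism.Build _ _ phi phiB.
pose phiA : {additive Jac (GZ G) -> Phi G} := HB.pack phi mphi.
exists phiA => /=; split => //.
- have /choice[psi phiK] f : exists x, phi x = f.
    have [c cE] := functional_surj bdry_p (repr f).
    have Dc : degree (bdry c) = 0 by apply: degree_bdry.
    by exists (\pi_(Jac (GZ G)) (inKer Dc)); rewrite (phiE c) // -cE reprK.
  have phi_inj : injective phi.
    move=> x y; have [c [D Dc ->]] := classP x.
    have [c' [D' Dc' ->]] := classP y.
    rewrite (phiE c D) // (phiE c' D') // => /eqP.
    rewrite -Quotient.idealrBE -raddfB -(functional_Prin bdry_p).
    rewrite raddfB /= -Dc -Dc' => H.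
    by apply/eqP; rewrite -Quotient.idealrBE; exact: H.
  by exists psi => // x; apply: phi_inj.
- move=> s x; have [c [D Dc ->]] := classP x.
  rewrite Jac_act_pi (phiE c D) // Phi_act_pi -functional_act; apply: phiE.
  by rewrite /= bdry_act Dc.
Qed.
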